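(* Suppose that $\bar E^\top\bar E=\kappa Q$ for some $\kappa>0$. Let $v_i$ be a generalized eigenvector of $\left(\bar E^\top(2\Pi_{\mathcal R(\bar F)}-I)\bar E,\ \bar E^\top\bar E\right)$ with associated generalized eigenvalue $\lambda_i$. Then the ADMM transition matrix $M$ has two right eigenvectors of the form $[v_i^\top\ w_{i1}^\top]^\top$ and $[v_i^\top\ w_{i2}^\top]^\top$ whose associated eigenvalues $\phi_{i1}$ and $\phi_{i2}$ are the solutions to the quadratic equation $$\phi_i^2+a_1(\lambda_i)\phi_i+a_0(\lambda_i)=0,$$ where $$a_1(\lambda_i)=\alpha-\alpha\beta\lambda_i-2,\qquad a_0(\lambda_i)=\alpha\beta\left(1-\frac\alpha2\right)\lambda_i+\frac12\alpha^2\beta+1-\alpha,\qquad \beta=\frac{\rho\kappa}{1+\rho\kappa}.$$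
   Context: $Q\in\mathbf R^{n\times n}$ is symmetric with $Q\succ0$; $\bar E\in\mathbf R^{r\times n}$ and $\bar F\in\mathbf R^{r\times m}$ have full column rank; $\rho>0$ (step-size) and $\alpha\in(0,2]$ (relaxation parameter) are scalars. $\mathcal R(\cdot)$ denotes range, $\Pi_{\mathcal S}$ the orthogonal projector onto the subspace $\mathcal S$. A generalized eigenvalue/eigenvector of $(B,D)$, $D$ invertible, is a pair $\lambda$, $v\ne0$ with $(B-\lambda D)v=0$. The ADMM transition matrix (for the problem of minimizing $\tfrac12x^\top Qx+q^\top x+c^\top z$ subject to $\bar Ex+\bar Fz=0$) is $M=\begin{bmatrix} M_{11} & M_{12} \\ M_{21} & (1-\alpha)I \end{bmatrix}\in\mathbf R^{2n\times2n}$ with $$M_{11}=\alpha\rho(Q+\rho\bar E^\top\bar E)^{-1}\bar E^\top(2\Pi_{\mathcal R(\bar F)}-I)\bar E+I,\quad M_{12}=\alpha\rho(Q+\rho\bar E^\top\bar E)^{-1},\quad M_{21}=-\alpha\bar E^\top\Pi_{\mathcal R(\bar F)}\bar E.$$ Eigenvectors may be complex. *)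

(* Defs.v *)
From mathcomp Require Import all_boot all_order all_algebra.
From mathcomp.real_closed Require Import complex.

Set Implicit Arguments.
Unset Strict Implicit.
Unset Printing Implicit Defensive.

Import Order.TTheory GRing.Theory Num.Theory.

Local Open Scope ring_scope.
Local Open Scope complex_scope.

Definition posdefmx (R : rcfType) (n : nat) (Q : 'M[R]_n) : Prop :=
  forall x : 'cV[R]_n, x != 0 -> 0 < (x^T *m Q *m x) 0 0.

(* MathComp subspaces are row spaces, on which matrices act from the right.
   The column range of F is thus the row space of F^T, and its orthogonal
   complement {u | u *m F = 0} is kermx F.  proj_mx projects row vectors onto
   the former along the latter; the outer transpose turns it into a matrix
   acting on column vectors.  *)
Definition range_proj (R : rcfType) (r m : nat) (F : 'M[R]_(r, m)) : 'M[R]_r :=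
  (proj_mx <<F^T>>%MS (kermx F))^T.

Lemma range_kermx_cap (R : rcfType) (r m : nat) (F : 'M[R]_(r, m)) :
  (<<F^T>> :&: kermx F = 0)%MS.
Proof.
apply/eqP/rowV0P => u; rewrite sub_capmx genmxE => /andP[/submxP[w uE]].
move=> /sub_kermxP uF0.
have uu0 : u *m u^T = 0.
  by rewrite {1}uE -mulmxA -trmx_mul uF0 trmx0 mulmx0.
apply/rowP => j; rewrite [RHS]mxE.
have /eqP : (u *m u^T) 0 0 = 0 by rewrite uu0 mxE.
rewrite mxE psumr_eq0; last by move=> i _; rewrite mxE -expr2 sqr_ge0.
by move=> /allP/(_ j (mem_index_enum _))/=; rewrite mxE -expr2 sqrf_eq0 => /eqP.
Qed.

Lemma range_proj_in (R : rcfType) (r m : nat) (F : 'M[R]_(r, m))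
    (x : 'cV[R]_r) :
  exists y : 'cV[R]_m, range_proj F *m x = F *m y.
Proof.
have := proj_mx_sub <<F^T>>%MS (kermx F) x^T.
rewrite genmxE => /submxP[w wE]; exists w^T.
by apply: trmx_inj; rewrite !trmx_mul !trmxK.
Qed.

Lemma range_proj_orth (R : rcfType) (r m : nat) (F : 'M[R]_(r, m))
    (x : 'cV[R]_r) :
  F^T *m (x - range_proj F *m x) = 0.
Proof.
have full : (x^T <= <<F^T>> + kermx F)%MS.
  apply: submx_full; rewrite /row_full mxrank_disjoint_sum ?range_kermx_cap //.
  by rewrite genmxE mxrank_tr mxrank_ker subnKC // rank_leq_row.
have := proj_mx_compl_sub full => /sub_kermxP fx0.
by apply: trmx_inj; rewrite trmx_mul trmxK linearB /= trmx_mul trmxK fx0 trmx0.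
Qed.

Definition right_eigenpair (K : fieldType) (n : nat) (M : 'M[K]_n)
    (phi : K) (u : 'cV[K]_n) : Prop :=
  u != 0 /\ M *m u = phi *: u.

(* Meant for invertible D. *)
Definition gen_eigenpair (K : fieldType) (n : nat) (B D : 'M[K]_n)
    (lambda : K) (v : 'cV[K]_n) : Prop :=
  v != 0 /\ (B - lambda *: D) *m v = 0.

Definition complexmx (R : rcfType) (m n : nat) (A : 'M[R]_(m, n)) :
    'M[R[i]]_(m, n) :=
  map_mx (real_complex R) A.

Section ADMM.
Variables (R : rcfType) (n r m : nat).
Variables (Q : 'M[R]_n) (E : 'M[R]_(r, n)) (F : 'M[R]_(r, m)).
Variables rho alpha : R.

Definition admm_reflection : 'M[R]_n :=
  E^T *m (2 *: range_proj F - 1%:M) *m E.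

Definition admm_M11 : 'M[R]_n :=
  (alpha * rho) *: (invmx (Q + rho *: (E^T *m E)) *m admm_reflection) + 1%:M.

Definition admm_M12 : 'M[R]_n :=
  (alpha * rho) *: invmx (Q + rho *: (E^T *m E)).

Definition admm_M21 : 'M[R]_n := - (alpha *: (E^T *m range_proj F *m E)).

Definition admm_matrix : 'M[R]_(n + n) :=
  block_mx admm_M11 admm_M12 admm_M21 (1 - alpha)%:M.

End ADMM.

Definition admm_beta (R : rcfType) (rho kappa : R) : R :=
  rho * kappa / (1 + rho * kappa).

Definition admm_a1 (R : rcfType) (alpha beta : R) (lambda : R[i]) : R[i] :=
  alpha%:C - alpha%:C * beta%:C * lambda - 2.

Definition admm_a0 (R : rcfType) (alpha beta : R) (lambda : R[i]) : R[i] :=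
  alpha%:C * beta%:C * (1 - alpha%:C / 2) * lambda
  + 2^-1 * alpha%:C ^+ 2 * beta%:C + 1 - alpha%:C.

(* Main.v *)
Require Import Defs.
From mathcomp Require Import all_boot all_order all_algebra.
From mathcomp.real_closed Require Import complex.
From mathcomp Require Import ring.

(** When [G = E^T *m E] is a multiple of [Q], so is [Q + rho *: G], and the
    blocks of the transition matrix simplify to
      [M11 = c *: (G^-1 *m N) + 1],  [M12 = c *: G^-1],
      [M21 = - (alpha / 2) *: (N + G)],
    where [N] is the reflected Gram matrix [E^T (2 Pi - 1) E] and
    [c = alpha * beta] ([admm_matrix_gram]).  If [N v = lambda G v], then [M]
    maps the set of vectors [(a v, b G v)] into itself, and in the coordinates
    [(a, b)] it acts there as the 2 x 2 matrix
      [[1 + c lambda, c], [- alpha (1 + lambda) / 2, 1 - alpha]],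
    whose characteristic polynomial is the quadratic of the theorem.  As
    [c != 0], no eigenvector of this matrix has [a = 0]; normalizing [a = 1],
    the first row forces [b = (phi - 1 - c lambda) / c] and the second row then
    says that [phi] is a root ([gram_block_eigenpair]).  Over the complex
    numbers both roots exist.  Distinct roots give distinct [b], hence distinct
    lower blocks, because [G] is invertible and so [G v != 0]. *)

Set Implicit Arguments.
Unset Strict Implicit.
Unset Printing Implicit Defensive.

Import Order.TTheory GRing.Theory Num.Theory.

Local Open Scope ring_scope.
Local Open Scope complex_scope.

Lemma posdefmx_unit (R : rcfType) (n : nat) (Q : 'M[R]_n) :
  posdefmx Q -> Q \in unitmx.
Proof.
move=> Qpos; rewrite -row_free_unit -kermx_eq0.
apply/rowV0P => u /sub_kermxP uQ0.
apply/eqP; apply: contraT => u_neq0.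
have := Qpos u^T; rewrite trmx_eq0 => /(_ u_neq0).
by rewrite trmxK uQ0 mul0mx mxE ltxx.
Qed.

Lemma monic_quadratic_split (C : numClosedFieldType) (a1 a0 : C) :
  exists phi1 phi2 : C, forall phi : C,
    phi ^+ 2 + a1 * phi + a0 = (phi - phi1) * (phi - phi2).
Proof.
pose s := sqrtC (a1 ^+ 2 - 4 * a0).
have a0E : a0 = (a1 ^+ 2 - s ^+ 2) / 4 by rewrite sqrtCK; field.
by exists ((- a1 + s) / 2), ((- a1 - s) / 2) => phi; rewrite a0E; field.
Qed.

(** The scalar in front of [G *m v] is the one that makes the upper block of
    the eigenvector equation hold; the quadratic is the lower block. *)
Lemma gram_block_eigenpair (K : fieldType) (n : nat) (G N : 'M[K]_n)
    (v : 'cV[K]_n) (lambda phi a c d : K) :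
  G \in unitmx -> c != 0 -> v != 0 -> N *m v = lambda *: (G *m v) ->
  (phi - 1 + a) * (phi - 1 - c * lambda) + c * d * (1 + lambda) = 0 ->
  right_eigenpair
    (block_mx (c *: (invmx G *m N) + 1%:M) (c *: invmx G)
              (- (d *: (N + G))) (1 - a)%:M)
    phi (col_mx v (((phi - 1 - c * lambda) / c) *: (G *m v))).
Proof.
move=> Gunit c_neq0 v_neq0 Nv phi_root; split.
  by rewrite col_mx_eq0 negb_and v_neq0.
set s := (_ / c); have sE : c * s = phi - 1 - c * lambda.
  by rewrite /s mulrC divfK.
rewrite mul_block_col scale_col_mx; congr col_mx.
  rewrite mulmxDl mul1mx -!scalemxAl -mulmxA Nv -!scalemxAr !mulKmx //.
  rewrite !scalerA sE -{2}[v]scale1r -!scalerDl; congr (_ *: _); ring.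
rewrite mulNmx -scalemxAl mulmxDl Nv mul_scalar_mx.
rewrite -{2}[G *m v]scale1r -scalerDl !scalerA -scaleNr -scalerDl.
congr (_ *: _); apply: (mulfI c_neq0); apply/eqP; rewrite -subr_eq0.
have -> : c * (- (d * (lambda + 1)) + (1 - a) * s) - c * (phi * s) =
  - ((phi - 1 + a) * (c * s) + c * d * (1 + lambda)) by ring.
by rewrite sE phi_root oppr0.
Qed.

(** The off-diagonal block [M21] involves the projector itself; it becomes a
    combination of the two matrices of the generalized eigenvalue problem
    because [2 Pi = (2 Pi - 1) + 1]. *)
Lemma admm_matrix_gram (R : rcfType) (n r m : nat)
    (Q : 'M[R]_n) (E : 'M[R]_(r, n)) (F : 'M[R]_(r, m)) (rho alpha kappa : R) :
  Q \in unitmx -> 0 < rho -> 0 < kappa -> E^T *m E = kappa *: Q ->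
  let G := E^T *m E in
  let N := admm_reflection E F in
  let c := alpha * admm_beta rho kappa in
  admm_matrix Q E F rho alpha =
    block_mx (c *: (invmx G *m N) + 1%:M) (c *: invmx G)
             (- ((alpha / 2) *: (N + G))) (1 - alpha)%:M.
Proof.
move=> Qunit rho_gt0 kappa_gt0 EQ G N c.
have kappa_neq0 : kappa != 0 by rewrite gt_eqF.
have den_neq0 : 1 + rho * kappa != 0.
  by rewrite gt_eqF // addr_gt0 ?ltr01 ?mulr_gt0.
have invE : (alpha * rho) *: invmx (Q + rho *: G) = c *: invmx G.
  have -> : Q + rho *: G = (1 + rho * kappa) *: Q.
    by rewrite /G EQ scalerA scalerDl scale1r.
  rewrite /G EQ !invmxZ ?unitmxZ ?unitfE // !scalerA; congr (_ *: _).
  by rewrite /c /admm_beta; field; rewrite kappa_neq0.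
rewrite /admm_matrix /admm_M11 /admm_M12 /admm_M21 -/G -/N invE.
congr block_mx; first by rewrite scalemxAl invE -scalemxAl.
congr (- _); rewrite /N /admm_reflection mulmxBr mulmxBl mulmx1 subrK.
by rewrite -scalemxAr -scalemxAl scalerA divfK ?pnatr_eq0.
Qed.

Theorem theorem2 (R : rcfType) (n r m : nat)
  (Q : 'M[R]_n) (E : 'M[R]_(r, n)) (F : 'M[R]_(r, m)) (rho alpha kappa : R)
  (Qsym : Q^T = Q) (Qpos : posdefmx Q)
  (Efull : \rank E = n) (Ffull : \rank F = m)
  (rho_gt0 : 0 < rho) (alpha_gt0 : 0 < alpha) (alpha_le2 : alpha <= 2)
  (kappa_gt0 : 0 < kappa) (EQ : E^T *m E = kappa *: Q)
  (lambda : R[i]) (v : 'cV[R[i]]_n)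
  (hv : gen_eigenpair (complexmx (admm_reflection E F))
                      (complexmx (E^T *m E)) lambda v) :
  let beta := admm_beta rho kappa in
  let M := complexmx (admm_matrix Q E F rho alpha) in
  exists (phi1 phi2 : R[i]) (w1 w2 : 'cV[R[i]]_n),
    [/\ forall phi : R[i],
          phi ^+ 2 + admm_a1 alpha beta lambda * phi
            + admm_a0 alpha beta lambda = (phi - phi1) * (phi - phi2),
        right_eigenpair M phi1 (col_mx v w1),
        right_eigenpair M phi2 (col_mx v w2)
      & phi1 != phi2 -> w1 != w2].
Proof.
move=> beta M.
set G := E^T *m E in hv *; set N := admm_reflection E F in hv *.
have Qunit := posdefmx_unit Qpos.
have Gunit : complexmx G \in unitmx.
  by rewrite map_unitmx /G EQ unitmxZ // unitfE gt_eqF.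
have beta_gt0 : 0 < beta.
  by rewrite divr_gt0 ?mulr_gt0 // addr_gt0 ?ltr01 ?mulr_gt0.
pose c := alpha%:C * beta%:C.
have c_neq0 : c != 0.
  by rewrite /c -rmorphM fmorph_eq0 gt_eqF // mulr_gt0.
have [v_neq0 Nv] : v != 0 /\ complexmx N *m v = lambda *: (complexmx G *m v).
  case: hv => v_neq0 /eqP; rewrite mulmxBl subr_eq0 -scalemxAl => /eqP Nv.
  by split.
have ME : M = block_mx
    (c *: (invmx (complexmx G) *m complexmx N) + 1%:M)
    (c *: invmx (complexmx G))
    (- ((alpha%:C / 2) *: (complexmx N + complexmx G))) (1 - alpha%:C)%:M.
  rewrite /M (admm_matrix_gram F alpha Qunit rho_gt0 kappa_gt0 EQ) /complexmx.
  rewrite map_block_mx map_mxD map_mxN !map_mxZ map_mxM map_mxD map_invmx.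
  rewrite !map_scalar_mx rmorph1 rmorphB rmorph1 /c.
  have -> : alpha%:C / 2 = (alpha / 2)%:C by rewrite rmorphM fmorphV rmorph_nat.
  by rewrite -rmorphM.
have [phi1 [phi2 phiE]] := monic_quadratic_split
  (admm_a1 alpha beta lambda) (admm_a0 alpha beta lambda).
pose w phi := ((phi - 1 - c * lambda) / c) *: (complexmx G *m v).
have eig phi : (phi - phi1) * (phi - phi2) = 0 ->
    right_eigenpair M phi (col_mx v (w phi)).
  move=> phi_root; rewrite ME; apply: gram_block_eigenpair => //.
  by rewrite -[RHS]phi_root -phiE /admm_a1 /admm_a0 /c; field.
exists phi1, phi2, (w phi1), (w phi2); split=> //.
- by apply: eig; rewrite subrr mul0r.
- by apply: eig; rewrite subrr mulr0.
apply: contra_neq => /eqP; rewrite -subr_eq0 -scalerBl scaler_eq0.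
have /negPf -> : complexmx G *m v != 0.
  by apply: contra_neq v_neq0 => Gv0; rewrite -[v](mulKmx Gunit) Gv0 mulmx0.
rewrite orbF subr_eq0 => /eqP /(mulIf (invr_neq0 c_neq0)).
by move=> /addIr /addIr.
Qed.
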